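(* Let $J=J(\{a_j\},\{b_j\},\{c_j\})_{j\in\mathbb N}$ be a semi-infinite Jacobi matrix with $J-J_0\in\mathcal S_1$. (i) With $\Delta:=\sum_{n=1}^\infty\bigl(|b_n|+|1-a_nc_n|\bigr)$, the discrete spectrum of $J$ is contained in the following Cassini oval: $$\sigma_d(J)\subset\left\{\lambda\in\mathbb C\setminus[-2,2]:\ |\lambda^2-4|\le\left(\frac{2\Delta}{\log2}\right)^2\right\}.$$ (ii) Assume in addition that $$\Delta_1:=\sum_{n=1}^\infty n\bigl(|b_n|+|1-a_{n-1}c_{n-1}|\bigr)<\infty,\qquad a_0=c_0:=1.$$ If $\Delta_1<\log2$, then $\sigma_d(J)=\emptyset$.
   Context: $\mathbb N=\{1,2,\dots\}$. $J=J(\{a_j\},\{b_j\},\{c_j\})_{j\in\mathbb N}$ is the operator on $\ell^2(\mathbb N)$ given by the semi-infinite tridiagonal matrix with diagonal entries $J_{k,k}=b_k$, superdiagonal entries $J_{k,k+1}=c_k$ and subdiagonal entries $J_{k+1,k}=a_k$, $k\ge1$, where $a_k,b_k,c_k$ are uniformly bounded complex numbers and $a_kc_k\ne0$ for all $k\in\mathbb N$. $J_0=J(\{1\},\{0\},\{1\})$ is the discrete Laplacian on the half-line, with spectrum $[-2,2]$. $\mathcal S_1$ is the trace class; $J-J_0\in\mathcal S_1$ is equivalent to $\sum_{n\ge1}(|1-a_n|+|b_n|+|1-c_n|)<\infty$. The discrete spectrum $\sigma_d(J)$ is the set of isolated eigenvalues of $J$ of finite algebraic multiplicity; when $J-J_0$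 is compact, $\sigma(J)=[-2,2]\cup\sigma_d(J)$ with $\sigma_d(J)\subset\mathbb C\setminus[-2,2]$. $\log$ is the natural logarithm. *)

(* Defs.v *)
From Stdlib Require Import Reals.
From Coquelicot Require Import Coquelicot.
Open Scope R_scope.

(** The index set {1, 2, ...} is represented by nat: [u n] is the entry with
    mathematical index n + 1. *)
Definition cseq : Type := nat -> C.

Definition l2 (u : cseq) : Prop := ex_series (fun n => (Cmod (u n) ^ 2)%R).

Definition l2norm (u : cseq) : R :=
  sqrt (Series (fun n => (Cmod (u n) ^ 2)%R)).

Definition l2inner (u v : cseq) : C :=
  (Series (fun n => Re (u n * Cconj (v n))%C),
   Series (fun n => Im (u n * Cconj (v n))%C)).

Definition cseq_sub (u v : cseq) : cseq := fun n => (u n - v n)%C.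

(** An operator is a map on sequences of which only the values on [l2] matter;
    equations between operators are required on [l2] only. *)
Definition bounded_operator (T : cseq -> cseq) : Prop :=
  (forall u : cseq, l2 u -> l2 (T u)) /\
  (forall (x : C) (u v : cseq), l2 u -> l2 v ->
     forall n : nat, T (fun k => x * u k + v k)%C n = (x * T u n + T v n)%C) /\
  (exists M : R, forall u : cseq, l2 u -> l2norm (T u) <= M * l2norm u).

Definition orthonormal (e : nat -> cseq) : Prop :=
  (forall i : nat, l2 (e i)) /\
  (forall i : nat, l2inner (e i) (e i) = RtoC 1) /\
  (forall i j : nat, i <> j -> l2inner (e i) (e j) = RtoC 0).

Fixpoint schmidt_sum (s : nat -> R) (e f : nat -> cseq) (u : cseq) (N : nat)
  : cseq :=
  match N with
  | O => fun _ => RtoC 0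
  | S N' => fun n =>
      (schmidt_sum s e f u N' n + RtoC (s N') * l2inner u (e N') * f N' n)%C
  end.

(** The Schatten class S_1: a Schmidt expansion T = sum_i s_i <., e_i> f_i
    with summable s. The nonzero s_i are the singular values of T; finite rank
    is covered by padding with s_i = 0. *)
Definition trace_class (T : cseq -> cseq) : Prop :=
  bounded_operator T /\
  exists (s : nat -> R) (e f : nat -> cseq),
    (forall i : nat, 0 <= s i) /\
    ex_series s /\
    orthonormal e /\
    orthonormal f /\
    (forall u : cseq, l2 u ->
       is_lim_seq (fun N => l2norm (cseq_sub (T u) (schmidt_sum s e f u N))) 0).

Definition is_resolvent (T : cseq -> cseq) (z : C) (S : cseq -> cseq) : Prop :=
  bounded_operator S /\
  forall u : cseq, l2 u ->
    (forall n : nat, S (fun k => z * u k - T u k)%C n = u n) /\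
    (forall n : nat, (z * S u n - T (S u) n)%C = u n).

Definition resolvent_set (T : cseq -> cseq) (z : C) : Prop :=
  exists S : cseq -> cseq, is_resolvent T z S.

Definition spectrum (T : cseq -> cseq) (z : C) : Prop := ~ resolvent_set T z.

Definition isolated_in_spectrum (T : cseq -> cseq) (z : C) : Prop :=
  spectrum T z /\
  exists eps : R, 0 < eps /\
    forall w : C, 0 < Cmod (w - z)%C < eps -> ~ spectrum T w.

Definition eigenvalue (T : cseq -> cseq) (z : C) : Prop :=
  exists u : cseq, l2 u /\ (exists n : nat, u n <> RtoC 0) /\
    forall n : nat, T u n = (z * u n)%C.

(** P = (1 / 2 pi i) * (integral of (w - T)^-1 over the circle |w - z| = r),
    read entrywise with w = z + r e^(it), so that dw = i r e^(it) dt; the punctured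
    closed disc of radius r must lie in the resolvent set. *)
Definition is_riesz_projection (T : cseq -> cseq) (z : C) (P : cseq -> cseq)
  : Prop :=
  exists (r : R) (Rs : C -> cseq -> cseq),
    0 < r /\
    (forall w : C, 0 < Cmod (w - z)%C <= r -> is_resolvent T w (Rs w)) /\
    (forall u : cseq, l2 u -> forall n : nat,
       is_RInt (V := C_R_NormedModule)
         (fun t : R =>
            let d : C := (r * cos t, r * sin t) in (d * Rs (z + d) u n)%C)
         0 (2 * PI) (RtoC (2 * PI) * P u n)%C).

Fixpoint lin_comb (x : nat -> C) (v : nat -> cseq) (N : nat) : cseq :=
  match N with
  | O => fun _ => RtoC 0
  | S N' => fun n => (lin_comb x v N' n + x N' * v N' n)%C
  end.

Definition finite_rank (P : cseq -> cseq) : Prop :=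
  exists (N : nat) (v : nat -> cseq), forall u : cseq, l2 u ->
    exists x : nat -> C, forall n : nat, P u n = lin_comb x v N n.

(** The algebraic multiplicity of an isolated eigenvalue is the rank of its
    Riesz projection. *)
Definition finite_algebraic_multiplicity (T : cseq -> cseq) (z : C) : Prop :=
  exists P : cseq -> cseq, is_riesz_projection T z P /\ finite_rank P.

Definition discrete_spectrum (T : cseq -> cseq) (z : C) : Prop :=
  isolated_in_spectrum T z /\ eigenvalue T z /\
  finite_algebraic_multiplicity T z.

(** Row k of the matrix is (a_(k-1), b_k, c_k): subdiagonal a, superdiagonal c. *)
Definition jacobi (a b c : cseq) (u : cseq) : cseq := fun n =>
  (match n with O => RtoC 0 | S m => a m * u m end
   + b n * u n + c n * u (S n))%C.

Definition jacobi0 : cseq -> cseq :=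
  jacobi (fun _ => RtoC 1) (fun _ => RtoC 0) (fun _ => RtoC 1).

Definition segment22 (z : C) : Prop :=
  exists x : R, -2 <= x <= 2 /\ z = RtoC x.

(** The sequence x_0, x_1, x_2, ... extending x_1, x_2, ... by x_0 = 1; here,
    unlike for [x] itself, argument and mathematical index agree. *)
Definition prepend_one (x : cseq) : cseq := fun n =>
  match n with O => RtoC 1 | S m => x m end.

(** Terms of Delta and Delta_1 with mathematical index n + 1. *)
Definition Delta_term (a b c : cseq) (n : nat) : R :=
  Cmod (b n) + Cmod (1 - a n * c n)%C.

Definition Delta1_term (a b c : cseq) (n : nat) : R :=
  INR (S n) * (Cmod (b n) + Cmod (1 - prepend_one a n * prepend_one c n)%C).

(* Main.v *)
Require Import Defs.
From Stdlib Require Import Reals Arith Lra Lia Classical.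
From Coquelicot Require Import Coquelicot.
Open Scope R_scope.

(** Let [u] be a square summable solution of [J u = z u]. Multiplying [u n] by
    [c 0 * ... * c (n-1)], a bounded factor, produces a decaying solution of a
    recursion with superdiagonal coefficients 1,
      [V (n+2) = (z - b n) V (n+1) - A n V n],  [V 0 = 0],
    where [A n] is the product [a (n-1) * c (n-1)], and [A 0 = 1], so that only
    [b n] and [1 - A n] measure the distance from the free recursion. Write
    [z = k + 1/k] with [|k| <= 1] and [W n = k^n V n]. The free recursion then
    has the characteristic roots [1] and [p = k^2], and
      [W (n+2) - (1 + p) W (n+1) + p W n = h n],
    with [|h n| <= |k| (|b n| + |1 - A n|) max (|W n|, |W (n+1)|)].

    Eliminating one root leaves a first order recursion for each filtered
    sequence: [E n = W (n+1) - p W n] satisfies [E (n+1) = E n + h n], and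
    [F n = W (n+1) - W n] satisfies [F (n+1) = p F n + h n]. Both are bounded by
    [X n = |W 1| + sum_(j < n) |h j|], and [W] is recovered from them, with
    [|W| <= 2 X / |1 - p|] (from [(1 - p) W n = E n - F n]) or [|W n| <= n X]
    (by summing [F]). Inserting either bound into the bound for [h] and
    applying Gronwall gives [X n <= exp L * |W 1|], where [L] is
    [2 |k| Delta / |1 - k^2| = 2 Delta / sqrt |z^2 - 4|], respectively [Delta_1].
    Hence [|E n - E 0| <= (exp L - 1) |W 1|] while [E 0 = W 1]. If [L < ln 2]
    then [E] stays away from 0, which contradicts the decay of [W]. This proves
    both bounds on eigenvalues: [forced_not_decaying] and
    [eigenvector_excluded] carry the argument.

    An isolated point of the spectrum avoids [-2,2] because the open interval
    consists of spectrum. Indeed, for [-2 < x < 2] the root [k] can be taken on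
    the unit circle with [k^2 <> 1]. Then [E] and [F] can be estimated from
    infinity, by the tail of [h], and this forces a decaying solution to vanish
    far out ([forced_decaying_eventually_zero]), hence everywhere, by running the
    recursion backwards. Applied to the image of the
    first basis vector under a resolvent at [x], which solves the homogeneous
    equation in every row but the first, it gives a contradiction in the first
    row ([interior_in_spectrum]).

    The series Delta converges since the diagonals of a trace class matrix are
    absolutely summable: in a Schmidt expansion with singular values [s i] each
    rank one term contributes at most [s i] to such a sum
    ([trace_class_diagonal]). *)

(** * Sums of nonnegative series *)

(** The empty sum has to be available, whereas [sum_n] always includes the
    term of index 0. *)
Fixpoint psum (f : nat -> R) (n : nat) : R :=
  match n with O => 0 | S m => psum f m + f m end.

Lemma psum_sum_n (f : nat -> R) (n : nat) : psum f (S n) = sum_n f n.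
Proof.
  induction n as [|n IH].
  - rewrite sum_O; simpl; lra.
  - rewrite sum_Sn, <- IH; reflexivity.
Qed.

Lemma psum_le (f g : nat -> R) (n : nat) :
  (forall k, f k <= g k) -> psum f n <= psum g n.
Proof.
  intros H; induction n as [|n IH]; simpl; [lra|].
  specialize (H n); lra.
Qed.

Lemma psum_ext (f g : nat -> R) (n : nat) :
  (forall k, f k = g k) -> psum f n = psum g n.
Proof. intros H; apply Rle_antisym; apply psum_le; intros k; rewrite H; lra. Qed.

Lemma psum_scal (x : R) (f : nat -> R) (n : nat) :
  psum (fun k => x * f k) n = x * psum f n.
Proof. induction n as [|n IH]; simpl; [|rewrite IH]; ring. Qed.

Lemma psum_plus (f g : nat -> R) (n : nat) :
  psum (fun k => f k + g k) n = psum f n + psum g n.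
Proof. induction n as [|n IH]; simpl; [|rewrite IH]; ring. Qed.

Lemma psum_shift (f : nat -> R) (p n : nat) :
  psum (fun k => f (k + p)%nat) n = psum f (n + p) - psum f p.
Proof.
  induction n as [|n IH]; simpl; [ring|]. rewrite IH; ring.
Qed.

Lemma psum_nonneg (f : nat -> R) (n : nat) :
  (forall k, 0 <= f k) -> 0 <= psum f n.
Proof.
  intros H; induction n as [|n IH]; simpl; [lra|]. specialize (H n); lra.
Qed.

Lemma is_lim_psum (f : nat -> R) :
  ex_series f -> is_lim_seq (psum f) (Series f).
Proof.
  intros H; apply is_lim_seq_incr_1.
  apply is_lim_seq_ext with (sum_n f).
  - intros n; symmetry; apply psum_sum_n.
  - exact (Series_correct f H).
Qed.

Lemma psum_le_Series (f : nat -> R) (n : nat) :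
  (forall k, 0 <= f k) -> ex_series f -> psum f n <= Series f.
Proof.
  intros Hf H.
  apply (is_lim_seq_incr_compare (psum f)).
  - now apply is_lim_psum.
  - intros k; simpl; specialize (Hf k); lra.
Qed.

Lemma ex_series_psum_bounded (f : nat -> R) (M : R) :
  (forall k, 0 <= f k) -> (forall n, psum f n <= M) -> ex_series f.
Proof.
  intros Hf HM.
  destruct (ex_finite_lim_seq_incr (sum_n f) M) as [l Hl].
  - intros n; rewrite <- !psum_sum_n; simpl; specialize (Hf (S n)); lra.
  - intros n; rewrite <- psum_sum_n; apply HM.
  - exists l; exact Hl.
Qed.

Lemma ex_series_dominated (f g : nat -> R) :
  (forall k, 0 <= f k <= g k) -> ex_series g -> ex_series f.
Proof.
  intros H Hg. apply ex_series_psum_bounded with (Series g); [apply H|].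
  intros n. apply Rle_trans with (psum g n); [apply psum_le, H|].
  apply psum_le_Series; [|exact Hg]. intros k. specialize (H k). lra.
Qed.

Lemma gronwall (X d : nat -> R) (n : nat) :
  0 <= X O -> (forall k, 0 <= d k) -> (forall k, X (S k) <= (1 + d k) * X k) ->
  X n <= exp (psum d n) * X O.
Proof.
  intros HX Hd Hrec; induction n as [|n IH]; simpl.
  - rewrite exp_0; lra.
  - rewrite exp_plus.
    pose proof (exp_ineq1_le (d n)) as He.
    pose proof (exp_pos (psum d n)) as Hp.
    pose proof (Hd n) as Hdn.
    apply Rle_trans with ((1 + d n) * X n); [apply Hrec|].
    apply Rle_trans with ((1 + d n) * (exp (psum d n) * X O)).
    + apply Rmult_le_compat_l; lra.
    + replace (exp (psum d n) * exp (d n) * X O)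
        with (exp (d n) * (exp (psum d n) * X O)) by ring.
      apply Rmult_le_compat_r; [apply Rmult_le_pos|]; lra.
Qed.

(** * Recursions with characteristic roots 1 and p *)
Lemma Cmod_triangle_sub (x y : C) : Cmod (x - y) <= Cmod x + Cmod y.
Proof. unfold Cminus; rewrite <- (Cmod_opp y); apply Cmod_triangle. Qed.

(** The equation [W (n+2) - (1 + p) W (n+1) + p W n = h n], written so as to
    show the conserved quantity [W (n+1) - p W n] of the case [h = 0]. *)
Definition forced (p : C) (W h : cseq) : Prop :=
  forall n, (W (S (S n)) - p * W (S n) = W (S n) - p * W n + h n)%C.

(** A common bound for both filtered sequences when [W 0 = 0]: each equals [W 1]
    at index 0 and moves by at most [|h n|] in one step. *)
Definition majorant (W h : cseq) (n : nat) : R :=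
  Cmod (W 1%nat) + psum (fun k => Cmod (h k)) n.

Lemma majorant_S (W h : cseq) (n : nat) :
  majorant W h (S n) = majorant W h n + Cmod (h n).
Proof. unfold majorant; simpl; ring. Qed.

Lemma majorant_nonneg (W h : cseq) (n : nat) : 0 <= majorant W h n.
Proof.
  unfold majorant; apply Rplus_le_le_0_compat; [apply Cmod_ge_0|].
  apply psum_nonneg; intros; apply Cmod_ge_0.
Qed.

(** Filtering out the root [p] leaves [E (n+1) = E n + h n], so [E n] differs
    from [E 0 = W 1] by a partial sum of [h]. *)
Lemma forced_filter_p (p : C) (W h : cseq) (n : nat) :
  W O = RtoC 0 -> forced p W h ->
  Cmod (W (S n) - p * W n - W 1%nat)%C <= majorant W h n - Cmod (W 1%nat) /\
  Cmod (W (S n) - p * W n)%C <= majorant W h n.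
Proof.
  intros H0 H.
  assert (A : Cmod (W (S n) - p * W n - W 1%nat)%C
              <= majorant W h n - Cmod (W 1%nat)).
  { unfold majorant. induction n as [|n IH]; simpl.
    - rewrite H0. replace (W 1%nat - p * 0 - W 1%nat)%C with (RtoC 0) by ring.
      rewrite Cmod_0; lra.
    - rewrite (H n).
      replace (W (S n) - p * W n + h n - W 1%nat)%C
        with ((W (S n) - p * W n - W 1%nat) + h n)%C by ring.
      eapply Rle_trans; [apply Cmod_triangle|]. lra. }
  split; [exact A|].
  replace (W (S n) - p * W n)%C
    with ((W (S n) - p * W n - W 1%nat) + W 1%nat)%C by ring.
  eapply Rle_trans; [apply Cmod_triangle|]. lra.
Qed.

(** Filtering out the root [1] leaves [F (n+1) = p F n + h n], where [F 0 = W 1];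
    this does not grow in the absence of [h] since [|p| <= 1]. *)
Lemma forced_filter_1 (p : C) (W h : cseq) (n : nat) :
  Cmod p <= 1 -> W O = RtoC 0 -> forced p W h ->
  Cmod (W (S n) - W n)%C <= majorant W h n.
Proof.
  intros Hp H0 H. induction n as [|n IH].
  - rewrite H0. replace (W 1%nat - 0)%C with (W 1%nat) by ring.
    unfold majorant; simpl; lra.
  - rewrite majorant_S.
    replace (W (S (S n)) - W (S n))%C with (p * (W (S n) - W n) + h n)%C.
    + eapply Rle_trans; [apply Cmod_triangle|]. rewrite Cmod_mult.
      pose proof (Cmod_ge_0 (W (S n) - W n)%C).
      pose proof (Cmod_ge_0 p). nra.
    + specialize (H n).
      replace (W (S (S n)))
        with ((W (S (S n)) - p * W (S n)) + p * W (S n))%C by ring.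
      rewrite H; ring.
Qed.

(** With [E] and [F] the two filtered sequences, [(1 - p) W n = E n - F n] and
    [(1 - p) W (n+1) = E n - p F n]. *)
Lemma forced_bound_uniform (p : C) (W h : cseq) (n : nat) :
  Cmod p <= 1 -> W O = RtoC 0 -> forced p W h ->
  Cmod (1 - p)%C * Cmod (W n) <= 2 * majorant W h n /\
  Cmod (1 - p)%C * Cmod (W (S n)) <= 2 * majorant W h n.
Proof.
  intros Hp H0 H.
  destruct (forced_filter_p p W h n H0 H) as [_ HE].
  pose proof (forced_filter_1 p W h n Hp H0 H) as HF.
  pose proof (Cmod_ge_0 p).
  pose proof (Cmod_ge_0 (W (S n) - W n)%C).
  split; rewrite <- Cmod_mult.
  - replace ((1 - p) * W n)%C
      with ((W (S n) - p * W n) - (W (S n) - W n))%C by ring.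
    eapply Rle_trans; [apply Cmod_triangle_sub|]. lra.
  - replace ((1 - p) * W (S n))%C
      with ((W (S n) - p * W n) - p * (W (S n) - W n))%C by ring.
    eapply Rle_trans; [apply Cmod_triangle_sub|]. rewrite Cmod_mult. nra.
Qed.

(** Summing the differences [W (n+1) - W n] costs a factor [n], but no division
    by [1 - p], so the bound is uniform up to [p = 1]. *)
Lemma forced_bound_linear (p : C) (W h : cseq) (n : nat) :
  Cmod p <= 1 -> W O = RtoC 0 -> forced p W h ->
  Cmod (W n) <= INR n * majorant W h n.
Proof.
  intros Hp H0 H. induction n as [|n IH].
  - rewrite H0, Cmod_0; simpl; lra.
  - pose proof (forced_filter_1 p W h n Hp H0 H) as HF.
    replace (W (S n)) with (W n + (W (S n) - W n))%C by ring.
    eapply Rle_trans; [apply Cmod_triangle|].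
    rewrite majorant_S, S_INR.
    pose proof (Cmod_ge_0 (h n)). pose proof (pos_INR n). nra.
Qed.

Lemma forced_bound_linear_S (p : C) (W h : cseq) (n : nat) :
  Cmod p <= 1 -> W O = RtoC 0 -> forced p W h ->
  Cmod (W (S n)) <= INR (S n) * majorant W h n.
Proof.
  intros Hp H0 H.
  pose proof (forced_bound_linear p W h n Hp H0 H) as HW.
  pose proof (forced_filter_1 p W h n Hp H0 H) as HF.
  replace (W (S n)) with (W n + (W (S n) - W n))%C by ring.
  eapply Rle_trans; [apply Cmod_triangle|]. rewrite S_INR; lra.
Qed.

(** The forcing is controlled by the majorant, so Gronwall bounds the majorant
    by [exp L * |W 1|], and the total variation of [W (n+1) - p W n] is at most
    [(exp L - 1) * |W 1|]. For [exp L < 2] this is less than its initial value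
    [|W 1|]. *)
Lemma forced_not_decaying (p : C) (W h : cseq) (d : nat -> R) (L : R) :
  Cmod p <= 1 -> W O = RtoC 0 -> W 1%nat <> RtoC 0 -> forced p W h ->
  (forall n, 0 <= d n) ->
  (forall n, Cmod (h n) <= d n * majorant W h n) ->
  (forall n, psum d n <= L) -> L < ln 2 ->
  ~ is_lim_seq (fun n => Cmod (W n)) 0.
Proof.
  intros Hp H0 H1 H Hd Hh HL HL2 Hlim.
  set (q := Cmod (W 1%nat)).
  assert (Hq : 0 < q) by now apply Cmod_gt_0.
  assert (HeL : exp L < 2).
  { rewrite <- (exp_ln 2) by lra. now apply exp_increasing. }
  assert (HX : forall n, majorant W h n <= exp L * q).
  { intros n. eapply Rle_trans.
    - apply (gronwall (majorant W h) d n); auto.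
      + apply majorant_nonneg.
      + intros k; rewrite majorant_S. specialize (Hh k). lra.
    - replace (majorant W h 0) with q by (unfold majorant, q; simpl; ring).
      apply Rmult_le_compat_r; [lra|].
      destruct (HL n) as [Hlt|Heq];
        [left; now apply exp_increasing | rewrite Heq; lra]. }
  assert (Hlow : forall n,
            q * (2 - exp L) <= Cmod (W (S n)) + Cmod (W n)).
  { intros n. destruct (forced_filter_p p W h n H0 H) as [HE _].
    fold q in HE. specialize (HX n).
    assert (q <= Cmod (W (S n)) + Cmod (p * W n)%C
                 + Cmod (W (S n) - p * W n - W 1%nat)%C).
    { unfold q at 1.
      replace (W 1%nat) with ((W (S n) - p * W n)
         - (W (S n) - p * W n - W 1%nat))%C at 1 by ring.
      eapply Rle_trans; [apply Cmod_triangle_sub|].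
      pose proof (Cmod_triangle_sub (W (S n)) (p * W n)%C). lra. }
    rewrite Cmod_mult in H2.
    pose proof (Cmod_ge_0 (W n)). nra. }
  assert (Hl2 : is_lim_seq (fun n => Cmod (W (S n)) + Cmod (W n)) (0 + 0)).
  { apply is_lim_seq_plus'; [|exact Hlim].
    now apply (is_lim_seq_incr_1 (fun n => Cmod (W n))). }
  assert (Hc : is_lim_seq (fun _ : nat => q * (2 - exp L)) (q * (2 - exp L)))
    by apply is_lim_seq_const.
  pose proof (is_lim_seq_le _ _ _ _ Hlow Hc Hl2) as Hle. simpl in Hle.
  assert (0 < q * (2 - exp L)) by (apply Rmult_lt_0_compat; lra).
  lra.
Qed.

(** * Decaying solutions on the unit circle *)
Lemma tail_bound (G g : nat -> R) (T : R) :
  (forall n, G n <= G (S n) + g n) -> is_lim_seq G 0 ->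
  (forall j, psum g j <= T) -> G O <= T.
Proof.
  intros HG Hlim HT.
  assert (H : forall j, G O <= G j + T).
  { intros j. apply Rle_trans with (G j + psum g j).
    - clear HT. induction j as [|j IH]; simpl; [lra|]. specialize (HG j). lra.
    - specialize (HT j). lra. }
  assert (Hl : is_lim_seq (fun j => G j + T) (0 + T))
    by (apply is_lim_seq_plus'; [exact Hlim | apply is_lim_seq_const]).
  pose proof (is_lim_seq_le _ _ _ _ H (is_lim_seq_const (G O)) Hl) as Hle.
  simpl in Hle. lra.
Qed.

Lemma filter_p_decays (W : cseq) (p : C) :
  is_lim_seq (fun n => Cmod (W n)) 0 ->
  is_lim_seq (fun n => Cmod (W (S n) - p * W n)%C) 0.
Proof.
  intros H.
  apply (is_lim_seq_le_le (fun _ => 0) _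
           (fun n => Cmod (W (S n)) + Cmod p * Cmod (W n))).
  - intros n; split; [apply Cmod_ge_0|].
    eapply Rle_trans; [apply Cmod_triangle_sub|]. rewrite Cmod_mult; lra.
  - apply is_lim_seq_const.
  - replace 0 with (0 + Cmod p * 0) by ring.
    apply is_lim_seq_plus'.
    + now apply (is_lim_seq_incr_1 (fun n => Cmod (W n))).
    + apply (is_lim_seq_scal_l (fun n => Cmod (W n)) (Cmod p) 0 H).
Qed.

(** If [|W| <= B] from [N] on, then the forcing from [N] on sums to at most [B]
    times the tail of [d]. Following both filtered sequences back from infinity,
    where they vanish, bounds them by the same amount, and their difference is
    [(1 - p) W n]. *)
Lemma forced_halving (p : C) (W h : cseq) (d : nat -> R) (N : nat) (B : R) :
  Cmod p = 1 -> p <> RtoC 1 -> forced p W h ->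
  is_lim_seq (fun n => Cmod (W n)) 0 ->
  (forall n, 0 <= d n) -> ex_series d ->
  (forall n B', Cmod (W n) <= B' -> Cmod (W (S n)) <= B' ->
                Cmod (h n) <= d n * B') ->
  Series d - psum d N <= Cmod (1 - p)%C / 4 -> 0 <= B ->
  (forall n, (N <= n)%nat -> Cmod (W n) <= B) ->
  forall n, (N <= n)%nat -> Cmod (W n) <= B / 2.
Proof.
  intros Hp Hp1 H Hlim Hd Hex Hh HN HB HW n Hn.
  assert (Hp0 : 0 < Cmod (1 - p)%C).
  { apply Cmod_gt_0. intros E. apply Hp1.
    replace p with (1 - (1 - p))%C by ring. rewrite E. ring. }
  set (tau := Cmod (1 - p)%C / 4) in *.
  assert (Htail : forall j,
            psum (fun i => Cmod (h (i + n)%nat)) j <= B * tau).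
  { intros j. apply Rle_trans with (psum (fun i => B * d (i + n)%nat) j).
    - apply psum_le; intros i. rewrite Rmult_comm.
      apply Hh; apply HW; lia.
    - rewrite psum_scal, psum_shift.
      apply Rmult_le_compat_l; [exact HB|].
      pose proof (psum_le_Series d (j + n) Hd Hex).
      assert (psum d N <= psum d n).
      { replace n with ((n - N) + N)%nat by lia.
        pose proof (psum_shift d N (n - N)) as Hs.
        pose proof (psum_nonneg (fun k => d (k + N)%nat) (n - N)
                      (fun k => Hd _)). lra. }
      lra. }
  assert (HE : Cmod (W (S n) - p * W n)%C <= B * tau).
  { apply (tail_bound (fun j => Cmod (W (S (j + n)) - p * W (j + n)%nat)%C)
             (fun i => Cmod (h (i + n)%nat))); [| |exact Htail].
    - intros j; simpl. rewrite (H (j + n)%nat).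
      replace (W (S (j + n)) - p * W (j + n)%nat)%C
        with ((W (S (j + n)) - p * W (j + n)%nat + h (j + n)%nat)
              - h (j + n)%nat)%C at 1 by ring.
      apply Cmod_triangle_sub.
    - apply (is_lim_seq_incr_n (fun j => Cmod (W (S j) - p * W j)%C) n).
      now apply filter_p_decays. }
  assert (HF : Cmod (W (S n) - 1 * W n)%C <= B * tau).
  { apply (tail_bound (fun j => Cmod (W (S (j + n)) - 1 * W (j + n)%nat)%C)
             (fun i => Cmod (h (i + n)%nat))); [| |exact Htail].
    - intros j; simpl.
      apply Rle_trans with (Cmod (p * (W (S (j + n)) - 1 * W (j + n)%nat))%C);
        [rewrite Cmod_mult, Hp; lra|].
      replace (p * (W (S (j + n)) - 1 * W (j + n)%nat))%C
        with ((W (S (S (j + n))) - 1 * W (S (j + n))) - h (j + n)%nat)%C.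
      + apply Cmod_triangle_sub.
      + replace (W (S (S (j + n)))) with
          ((W (S (S (j + n))) - p * W (S (j + n))) + p * W (S (j + n)))%C
          by ring.
        rewrite (H (j + n)%nat). ring.
    - apply (is_lim_seq_incr_n (fun j => Cmod (W (S j) - 1 * W j)%C) n).
      now apply filter_p_decays. }
  assert (Hs : Cmod (1 - p)%C * Cmod (W n) <= 2 * (B * tau)).
  { rewrite <- Cmod_mult.
    replace ((1 - p) * W n)%C
      with ((W (S n) - p * W n) - (W (S n) - 1 * W n))%C by ring.
    eapply Rle_trans; [apply Cmod_triangle_sub|]. lra. }
  apply Rmult_le_reg_l with (Cmod (1 - p)%C); [exact Hp0|].
  unfold tau in Hs. lra.
Qed.

(** Halving a bound that holds from a fixed index on can be repeated without
    moving that index, so the bound is 0. *)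
Lemma forced_decaying_eventually_zero (p : C) (W h : cseq) (d : nat -> R) :
  Cmod p = 1 -> p <> RtoC 1 -> forced p W h ->
  is_lim_seq (fun n => Cmod (W n)) 0 ->
  (forall n, 0 <= d n) -> ex_series d ->
  (forall n B, Cmod (W n) <= B -> Cmod (W (S n)) <= B ->
               Cmod (h n) <= d n * B) ->
  exists N, forall n, (N <= n)%nat -> W n = RtoC 0.
Proof.
  intros Hp Hp1 H Hlim Hd Hex Hh.
  assert (Hp0 : 0 < Cmod (1 - p)%C / 4).
  { assert (0 < Cmod (1 - p)%C); [|lra].
    apply Cmod_gt_0. intros E. apply Hp1.
    replace p with (1 - (1 - p))%C by ring. rewrite E. ring. }
  pose proof (is_lim_psum d Hex) as Hs.
  apply is_lim_seq_spec in Hs. destruct (Hs (mkposreal _ Hp0)) as [N1 HN1].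
  pose proof Hlim as Hl. apply is_lim_seq_spec in Hl.
  destruct (Hl (mkposreal 1 Rlt_0_1)) as [N2 HN2]. simpl in HN1, HN2.
  set (N := max N1 N2). exists N.
  assert (HN : Series d - psum d N <= Cmod (1 - p)%C / 4).
  { specialize (HN1 N ltac:(lia)). apply Rabs_def2 in HN1. lra. }
  assert (Hj : forall j n, (N <= n)%nat -> Cmod (W n) <= (/ 2) ^ j).
  { induction j as [|j IH].
    - intros n Hn. specialize (HN2 n ltac:(lia)). simpl.
      rewrite Rminus_0_r in HN2. apply Rabs_def2 in HN2. lra.
    - intros n Hn. simpl. rewrite Rmult_comm.
      apply (forced_halving p W h d N); auto.
      apply pow_le; lra. }
  intros n Hn. apply Cmod_eq_0. apply Rle_antisym; [|apply Cmod_ge_0].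
  assert (Hg : is_lim_seq (fun j => (/ 2) ^ j) 0)
    by (apply is_lim_seq_geom; rewrite Rabs_pos_eq; lra).
  exact (is_lim_seq_le _ _ _ _ (fun j => Hj j n Hn)
           (is_lim_seq_const (Cmod (W n))) Hg).
Qed.

(** * Reduction of a Jacobi matrix to the model recursion *)
Fixpoint cprod (c : cseq) (n : nat) : C :=
  match n with O => RtoC 1 | S m => (cprod c m * c m)%C end.

Lemma cprod_nonzero (c : cseq) (n : nat) :
  (forall k, c k <> RtoC 0) -> cprod c n <> RtoC 0.
Proof.
  intros H; induction n as [|n IH]; simpl.
  - intros E; apply (f_equal Re) in E; simpl in E; lra.
  - now apply Cmult_neq_0.
Qed.

Lemma cprod_bounded (c : cseq) :
  ex_series (fun n => Cmod (1 - c n)%C) ->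
  exists M, forall n, Cmod (cprod c n) <= M.
Proof.
  intros H. exists (exp (Series (fun n => Cmod (1 - c n)%C))). intros n.
  apply Rle_trans with (exp (psum (fun n => Cmod (1 - c n)%C) n)
                        * Cmod (cprod c 0)).
  - apply (gronwall (fun n => Cmod (cprod c n))).
    + apply Cmod_ge_0.
    + intros; apply Cmod_ge_0.
    + intros k; simpl. rewrite Cmod_mult, Rmult_comm.
      apply Rmult_le_compat_r; [apply Cmod_ge_0|].
      replace (c k) with (1 - (1 - c k))%C at 1 by ring.
      eapply Rle_trans; [apply Cmod_triangle_sub|]. rewrite Cmod_1; lra.
  - simpl; rewrite Cmod_1, Rmult_1_r.
    destruct (psum_le_Series (fun n => Cmod (1 - c n)%C) n
                (fun k => Cmod_ge_0 _) H) as [Hlt|Heq];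
      [left; now apply exp_increasing | rewrite Heq; lra].
Qed.

(** The gauge transformation making the superdiagonal entries 1. The leading
    zero encodes the boundary condition of the half-line, so that the recursion
    has the same form in all rows. *)
Definition monic (c u : cseq) : cseq := fun n =>
  match n with O => RtoC 0 | S m => (cprod c m * u m)%C end.

Lemma monic_rec (a b c u : cseq) (z : C) (n : nat) :
  jacobi a b c u n = (z * u n)%C ->
  monic c u (S (S n))
  = ((z - b n) * monic c u (S n)
     - prepend_one a n * prepend_one c n * monic c u n)%C.
Proof.
  unfold jacobi. destruct n as [|n]; simpl; intros H.
  - replace ((z - b 0%nat) * (1 * u 0%nat))%C
      with (z * u 0%nat - b 0%nat * u 0%nat)%C by ring.
    rewrite <- H. ring.
  - replace ((z - b (S n)) * (cprod c n * c n * u (S n)))%C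
      with (cprod c n * c n * (z * u (S n)) - b (S n) * cprod c n * c n * u (S n))%C
      by ring.
    rewrite <- H. ring.
Qed.

Lemma l2_decays (u : cseq) : l2 u -> is_lim_seq (fun n => Cmod (u n)) 0.
Proof.
  intros H. apply ex_series_lim_0 in H.
  apply is_lim_seq_ext with (fun n => sqrt (Cmod (u n) ^ 2)).
  - intros n. apply sqrt_pow2, Cmod_ge_0.
  - rewrite <- sqrt_0.
    apply (is_lim_seq_continuous sqrt (fun n => Cmod (u n) ^ 2) 0).
    + apply continuity_pt_sqrt; lra.
    + exact H.
Qed.

Lemma monic_decays (c u : cseq) :
  ex_series (fun n => Cmod (1 - c n)%C) -> l2 u ->
  is_lim_seq (fun n => Cmod (monic c u n)) 0.
Proof.
  intros Hc Hu. apply is_lim_seq_incr_1. simpl.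
  destruct (cprod_bounded c Hc) as [M HM].
  apply (is_lim_seq_le_le (fun _ => 0) _ (fun n => M * Cmod (u n))).
  - intros n; split; [apply Cmod_ge_0|]. rewrite Cmod_mult.
    apply Rmult_le_compat_r; [apply Cmod_ge_0 | apply HM].
  - apply is_lim_seq_const.
  - replace 0 with (M * 0) by ring.
    apply (is_lim_seq_scal_l (fun n => Cmod (u n)) M 0), l2_decays, Hu.
Qed.

(** In the variable [k^n V n] the characteristic roots [k] and [1/k] of the free
    recursion [V (n+2) - (k + 1/k) V (n+1) + V n = 0] become [k^2] and 1. *)
Definition twist (k : C) (V : cseq) : cseq := fun n => (k ^ n * V n)%C.

Definition forcing (A b : cseq) (k : C) (W : cseq) : cseq := fun n =>
  (k ^ 2 * (1 - A n) * W n - k * b n * W (S n))%C.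

Lemma twist_forced (A b V : cseq) (k z : C) (n : nat) :
  k <> RtoC 0 -> z = (k + / k)%C ->
  V (S (S n)) = ((z - b n) * V (S n) - A n * V n)%C ->
  (twist k V (S (S n)) - k ^ 2 * twist k V (S n)
   = twist k V (S n) - k ^ 2 * twist k V n + forcing A b k (twist k V) n)%C.
Proof.
  intros Hk Hz HV. unfold forcing, twist. rewrite HV, Hz, !Cpow_S.
  field. exact Hk.
Qed.

Lemma Cmod_pow_le_1 (k : C) (n : nat) : Cmod k <= 1 -> Cmod (k ^ n) <= 1.
Proof.
  intros H. rewrite Cmod_pow, <- (pow1 n). apply pow_incr.
  split; [apply Cmod_ge_0 | exact H].
Qed.

Lemma twist_decays (k : C) (V : cseq) :
  Cmod k <= 1 -> is_lim_seq (fun n => Cmod (V n)) 0 ->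
  is_lim_seq (fun n => Cmod (twist k V n)) 0.
Proof.
  intros Hk H.
  apply (is_lim_seq_le_le (fun _ => 0) _ (fun n => Cmod (V n))).
  - intros n; split; [apply Cmod_ge_0|]. unfold twist. rewrite Cmod_mult.
    pose proof (Cmod_pow_le_1 k n Hk). pose proof (Cmod_ge_0 (V n)). nra.
  - apply is_lim_seq_const.
  - exact H.
Qed.

Lemma forcing_bound (A b : cseq) (k : C) (W : cseq) (n : nat) (B : R) :
  Cmod k <= 1 -> Cmod (W n) <= B -> Cmod (W (S n)) <= B ->
  Cmod (forcing A b k W n)
  <= Cmod k * (Cmod (b n) + Cmod (1 - A n)%C) * B.
Proof.
  intros Hk H0 H1. unfold forcing.
  eapply Rle_trans; [apply Cmod_triangle_sub|].
  rewrite !Cmod_mult, Cmod_pow.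
  pose proof (Cmod_ge_0 k) as Hk0.
  pose proof (Cmod_ge_0 (b n)) as Hb.
  pose proof (Cmod_ge_0 (1 - A n)%C) as Ha.
  pose proof (Cmod_ge_0 (W n)) as HW.
  pose proof (Cmod_ge_0 (W (S n))) as HW1.
  replace (Cmod k * (Cmod (b n) + Cmod (1 - A n)%C) * B)
    with (Cmod k * Cmod (1 - A n)%C * B + Cmod k * Cmod (b n) * B) by ring.
  apply Rplus_le_compat.
  - apply Rmult_le_compat; [| exact HW | | exact H0].
    + apply Rmult_le_pos; [apply pow2_ge_0 | exact Ha].
    + apply Rmult_le_compat_r; [exact Ha | nra].
  - apply Rmult_le_compat_l; [nra|exact H1].
Qed.

(** The summand of Delta_1 without its weight. The product of off-diagonal
    entries is the one preceding row [n], because this is the product that occurs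
    in row [n] of the gauged recursion. *)
Definition perturbation (a b c : cseq) (n : nat) : R :=
  Cmod (b n) + Cmod (1 - prepend_one a n * prepend_one c n)%C.

Lemma perturbation_nonneg (a b c : cseq) (n : nat) : 0 <= perturbation a b c n.
Proof. apply Rplus_le_le_0_compat; apply Cmod_ge_0. Qed.

Lemma Delta_term_nonneg (a b c : cseq) (n : nat) : 0 <= Delta_term a b c n.
Proof. apply Rplus_le_le_0_compat; apply Cmod_ge_0. Qed.

(** The two sums differ by a shift of the second term by one index, and the
    extra initial term [1 - 1 * 1] is 0. *)
Lemma psum_perturbation (a b c : cseq) (n : nat) :
  psum (perturbation a b c) n <= psum (Delta_term a b c) n.
Proof.
  assert (H : psum (perturbation a b c) n
              + (match n with O => 0 | S m => Cmod (1 - a m * c m)%C end)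
              = psum (Delta_term a b c) n).
  { induction n as [|n IH]; simpl; [ring|]. rewrite <- IH.
    unfold perturbation, Delta_term; destruct n; simpl.
    - replace (1 - 1 * 1)%C with (RtoC 0) by ring. rewrite Cmod_0. ring.
    - ring. }
  rewrite <- H. destruct n as [|m]; [lra|].
  pose proof (Cmod_ge_0 (1 - a m * c m)%C). lra.
Qed.

(** * Bounds on eigenvalues *)
(** The common part of both bounds: the weight [beta] stands for the factor by
    which the majorant bounds solutions of the model recursion, constant for the
    Cassini oval and linear for the criterion in terms of Delta_1. *)
Lemma eigenvector_excluded (a b c u : cseq) (z k : C) (beta : nat -> R) (L : R) :
  ex_series (fun n => Cmod (1 - c n)%C) -> (forall n, c n <> RtoC 0) ->
  l2 u -> (exists n, u n <> RtoC 0) ->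
  (forall n, jacobi a b c u n = (z * u n)%C) ->
  k <> RtoC 0 -> Cmod k <= 1 -> z = (k + / k)%C ->
  (forall n, 0 <= beta n) ->
  (forall W h : cseq, W O = RtoC 0 -> forced (k ^ 2) W h -> forall n,
     Cmod (W n) <= beta n * majorant W h n /\
     Cmod (W (S n)) <= beta n * majorant W h n) ->
  (forall n, psum (fun j => Cmod k * perturbation a b c j * beta j) n <= L) ->
  L < ln 2 -> False.
Proof.
  intros Hc Hc0 Hu [n0 Hn0] Heig Hk0 Hk Hz Hb0 Hbeta HL HL2.
  set (V := monic c u).
  set (W := twist k V).
  set (A := fun n => (prepend_one a n * prepend_one c n)%C).
  assert (HV : forall n, V (S (S n)) = ((z - b n) * V (S n) - A n * V n)%C)
    by (intros n; apply monic_rec, Heig).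
  assert (HW0 : W O = RtoC 0) by (unfold W, twist, V; simpl; ring).
  assert (HW : forced (k ^ 2) W (forcing A b k W))
    by (intros n; now apply twist_forced with z).
  apply (forced_not_decaying (k ^ 2) W (forcing A b k W)
           (fun j => Cmod k * perturbation a b c j * beta j) L); auto.
  - now apply Cmod_pow_le_1.
  - intros E.
    assert (HV1 : V 1%nat = RtoC 0).
    { unfold W, twist in E. apply NNPP; intros N. revert E.
      apply Cmult_neq_0; [now apply Cpow_nz | exact N]. }
    assert (HVn : forall n, V n = RtoC 0 /\ V (S n) = RtoC 0).
    { induction n as [|n [IH1 IH2]]; [split; [reflexivity|exact HV1]|].
      split; [exact IH2|]. rewrite HV, IH1, IH2. ring. }
    destruct (HVn n0) as [_ H]. revert H. unfold V; simpl.
    apply Cmult_neq_0; [now apply cprod_nonzero | exact Hn0].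
  - intros n. apply Rmult_le_pos; [apply Rmult_le_pos|apply Hb0].
    + apply Cmod_ge_0.
    + apply perturbation_nonneg.
  - intros n. destruct (Hbeta W (forcing A b k W) HW0 HW n) as [B0 B1].
    rewrite Rmult_assoc. now apply forcing_bound.
  - apply twist_decays; [exact Hk|]. now apply monic_decays.
Qed.

Lemma Csqrt_exists (w : C) : exists s : C, (s * s)%C = w.
Proof.
  destruct w as [x y]. set (r := Cmod (x, y)).
  assert (Hr : r * r = x * x + y * y).
  { unfold r, Cmod; simpl. rewrite sqrt_sqrt; nra. }
  assert (Hr0 : 0 <= r) by apply Cmod_ge_0.
  assert (H1 : 0 <= (r + x) / 2) by nra.
  assert (H2 : 0 <= (r - x) / 2) by nra.
  set (p := sqrt ((r + x) / 2)). set (q := sqrt ((r - x) / 2)).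
  assert (Hp : p * p = (r + x) / 2) by now apply sqrt_sqrt.
  assert (Hq : q * q = (r - x) / 2) by now apply sqrt_sqrt.
  assert (Hpq : p * q = Rabs y / 2).
  { unfold p, q. rewrite <- sqrt_mult by assumption.
    replace ((r + x) / 2 * ((r - x) / 2)) with (Rsqr (y / 2))
      by (unfold Rsqr; nra).
    rewrite sqrt_Rsqr_abs. unfold Rdiv. rewrite Rabs_mult.
    rewrite (Rabs_pos_eq (/ 2)) by lra. reflexivity. }
  destruct (Rle_dec 0 y) as [Hy|Hy].
  - exists (p, q). rewrite Rabs_pos_eq in Hpq by lra.
    apply injective_projections; simpl; lra.
  - exists (p, - q). rewrite Rabs_left in Hpq by lra.
    apply injective_projections; simpl; lra.
Qed.

(** The two roots of [k^2 - z k + 1] have product 1, so one of them lies in the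
    closed unit disc. *)
Lemma joukowski_preimage (z : C) :
  exists k : C, k <> RtoC 0 /\ Cmod k <= 1 /\ z = (k + / k)%C.
Proof.
  destruct (Csqrt_exists (z * z - 4)%C) as [s Hs].
  assert (Hgen : forall k1 k2 : C, (k1 * k2)%C = RtoC 1 -> (k1 + k2)%C = z ->
            Cmod k1 <= 1 ->
            exists k : C, k <> RtoC 0 /\ Cmod k <= 1 /\ z = (k + / k)%C).
  { intros k1 k2 Hm Ha Hk. exists k1.
    assert (Hk0 : k1 <> RtoC 0).
    { intros E. rewrite E, Cmult_0_l in Hm.
      apply (f_equal Re) in Hm; simpl in Hm; lra. }
    split; [exact Hk0|split; [exact Hk|]].
    rewrite <- Ha. f_equal.
    rewrite <- (Cmult_1_r (/ k1)), <- Hm. now field. }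
  set (k1 := ((z + s) / 2)%C). set (k2 := ((z - s) / 2)%C).
  assert (Hm : (k1 * k2)%C = RtoC 1).
  { unfold k1, k2.
    replace ((z + s) / 2 * ((z - s) / 2))%C
      with ((z * z - s * s) / (2 * 2))%C by field.
    rewrite Hs. field. }
  assert (Ha : (k1 + k2)%C = z) by (unfold k1, k2; field).
  destruct (Rle_dec (Cmod k1) 1) as [Hk|Hk]; [now apply (Hgen k1 k2)|].
  apply (Hgen k2 k1); [rewrite Cmult_comm; exact Hm
                      | rewrite Cplus_comm; exact Ha |].
  assert (E : Cmod k1 * Cmod k2 = 1) by (rewrite <- Cmod_mult, Hm; apply Cmod_1).
  pose proof (Cmod_ge_0 k2). nra.
Qed.

(** Since [z^2 - 4 = (k - 1/k)^2], lying outside the oval means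
    [2 |k| Delta / |1 - k^2| < ln 2], which is the smallness condition of
    [forced_not_decaying] for the constant weight [2 / |1 - k^2|]. *)
Lemma eigenvalue_in_Cassini_oval (a b c : cseq) (z : C) :
  ex_series (fun n => Cmod (1 - c n)%C) -> (forall n, c n <> RtoC 0) ->
  ex_series (Delta_term a b c) ->
  eigenvalue (jacobi a b c) z ->
  Cmod (z ^ 2 - 4)%C <= (2 * Series (Delta_term a b c) / ln 2) ^ 2.
Proof.
  intros Hc Hc0 HD [u [Hu [Hn Heig]]].
  destruct (joukowski_preimage z) as [k [Hk0 [Hk Hz]]].
  set (D := Series (Delta_term a b c)).
  assert (HD0 : 0 <= D).
  { apply (psum_le_Series (Delta_term a b c) 0); [|exact HD].
    apply Delta_term_nonneg. }
  assert (Hln : 0 < ln 2) by (rewrite <- ln_1; apply ln_increasing; lra).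
  apply Rnot_lt_le; intros Hlt.
  assert (Hkp : 0 < Cmod k) by now apply Cmod_gt_0.
  set (q := Cmod (1 - k ^ 2)%C).
  assert (Hq0 : 0 <= q) by apply Cmod_ge_0.
  assert (Hzq : Cmod (z ^ 2 - 4)%C * Cmod k ^ 2 = q ^ 2).
  { unfold q. rewrite <- !Cmod_pow, <- Cmod_mult. f_equal.
    rewrite Hz. field. exact Hk0. }
  assert (Hqk : 2 * D / ln 2 * Cmod k < q).
  { apply Rnot_le_lt; intros Hle.
    assert (q ^ 2 <= (2 * D / ln 2 * Cmod k) ^ 2)
      by (apply pow_incr; split; assumption).
    rewrite Rpow_mult_distr in H.
    assert (0 < Cmod k ^ 2) by now apply pow_lt. nra. }
  assert (Hqp : 0 < q).
  { apply Rle_lt_trans with (2 * D / ln 2 * Cmod k); [|exact Hqk].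
    apply Rmult_le_pos; [|lra].
    apply Rmult_le_pos; [lra | left; now apply Rinv_0_lt_compat]. }
  apply (eigenvector_excluded a b c u z k (fun _ => 2 / q)
           (2 * D * Cmod k / q)); auto.
  - intros _. left. apply Rdiv_lt_0_compat; lra.
  - intros W h HW0 HW n.
    destruct (forced_bound_uniform (k ^ 2) W h n
                (Cmod_pow_le_1 k 2 Hk) HW0 HW) as [B0 B1].
    fold q in B0, B1.
    assert (E : forall x y, q * x <= 2 * y -> x <= 2 / q * y).
    { intros x y Hxy. apply Rmult_le_reg_l with q; [exact Hqp|].
      replace (q * (2 / q * y)) with (2 * y) by (field; lra). exact Hxy. }
    split; apply E; assumption.
  - intros n.
    rewrite (psum_ext _ (fun j => (Cmod k * (2 / q)) * perturbation a b c j))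
      by (intros; ring).
    rewrite psum_scal.
    replace (2 * D * Cmod k / q) with (Cmod k * (2 / q) * D) by (field; lra).
    apply Rmult_le_compat_l.
    + apply Rmult_le_pos; [lra|]. left. apply Rdiv_lt_0_compat; lra.
    + eapply Rle_trans; [apply psum_perturbation|].
      apply psum_le_Series; [apply Delta_term_nonneg | exact HD].
  - apply Rmult_lt_reg_r with q; [exact Hqp|].
    replace (2 * D * Cmod k / q * q) with (2 * D * Cmod k) by (field; lra).
    apply Rmult_lt_compat_l with (r := ln 2) in Hqk; [|exact Hln].
    replace (ln 2 * (2 * D / ln 2 * Cmod k)) with (2 * D * Cmod k) in Hqk
      by (field; lra).
    exact Hqk.
Qed.

(** The linear weight turns the sum of the perturbation into Delta_1. It is
    insensitive to [k^2] being close or equal to 1, that is to [z] near 2 or -2. *)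
Lemma no_eigenvalue_small_first_moment (a b c : cseq) (z : C) :
  ex_series (fun n => Cmod (1 - c n)%C) -> (forall n, c n <> RtoC 0) ->
  ex_series (Delta1_term a b c) -> Series (Delta1_term a b c) < ln 2 ->
  ~ eigenvalue (jacobi a b c) z.
Proof.
  intros Hc Hc0 HD HD2 [u [Hu [Hn Heig]]].
  destruct (joukowski_preimage z) as [k [Hk0 [Hk Hz]]].
  apply (eigenvector_excluded a b c u z k (fun n => INR (S n))
           (Series (Delta1_term a b c))); auto.
  - intros n. apply pos_INR.
  - intros W h HW0 HW n. pose proof (Cmod_pow_le_1 k 2 Hk) as Hp. split.
    + eapply Rle_trans; [apply (forced_bound_linear (k ^ 2) W h n Hp HW0 HW)|].
      apply Rmult_le_compat_r; [apply majorant_nonneg|]. apply le_INR. lia.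
    + now apply (forced_bound_linear_S (k ^ 2)).
  - intros n. apply Rle_trans with (psum (Delta1_term a b c) n).
    + apply psum_le; intros j. unfold Delta1_term.
      fold (perturbation a b c j).
      pose proof (perturbation_nonneg a b c j) as Hpj.
      pose proof (pos_INR (S j)) as Hj.
      rewrite (Rmult_comm (INR (S j))).
      apply Rmult_le_compat_r; [exact Hj|]. nra.
    + apply psum_le_Series; [|exact HD]. intros j. unfold Delta1_term.
      apply Rmult_le_pos; [apply pos_INR | apply (perturbation_nonneg a b c j)].
Qed.

(** * The interval (-2,2) belongs to the spectrum *)
(** The preimage is [exp (i t)] for [x = 2 cos t], with [0 < t < PI]. *)
Lemma unit_joukowski_preimage (x : R) :
  -2 < x < 2 ->
  exists w : C, w <> RtoC 0 /\ Cmod w = 1 /\ (w ^ 2)%C <> RtoC 1 /\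
                RtoC x = (w + / w)%C.
Proof.
  intros Hx.
  set (s := sqrt (1 - x / 2 * (x / 2))).
  assert (Hpos : 0 < 1 - x / 2 * (x / 2)) by nra.
  assert (Hs : s * s = 1 - x / 2 * (x / 2)) by (apply sqrt_sqrt; lra).
  assert (Hs0 : 0 < s) by now apply sqrt_lt_R0.
  set (w := (x / 2, s) : C).
  assert (Hw0 : w <> RtoC 0)
    by (intros E; apply (f_equal Im) in E; simpl in E; lra).
  exists w. split; [exact Hw0|]. split; [|split].
  - unfold Cmod, w; simpl. transitivity (sqrt 1); [f_equal; lra | apply sqrt_1].
  - intros E. pose proof (f_equal Re E) as E1. pose proof (f_equal Im E) as E2.
    simpl in E1, E2. nra.
  - assert (E : (RtoC x * w)%C = (w * w + 1)%C)
      by (unfold w; apply injective_projections; simpl; lra).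
    replace (RtoC x) with (RtoC x * w * / w)%C by (field; exact Hw0).
    rewrite E. field. exact Hw0.
Qed.

Definition delta (j : nat) : cseq := fun n =>
  if Nat.eq_dec n j then RtoC 1 else RtoC 0.

Lemma delta_same (j : nat) : delta j j = RtoC 1.
Proof. unfold delta; destruct (Nat.eq_dec j j); [reflexivity|lia]. Qed.

Lemma delta_other (j n : nat) : n <> j -> delta j n = RtoC 0.
Proof. unfold delta; destruct (Nat.eq_dec n j); [lia|reflexivity]. Qed.

Lemma is_series_single (f : nat -> R) (j : nat) :
  (forall n, n <> j -> f n = 0) -> is_series f (f j).
Proof.
  intros Hf.
  assert (H : forall n, psum f n = if le_lt_dec n j then 0 else f j).
  { induction n as [|n IH];
      [destruct (le_lt_dec 0 j); [reflexivity|lia]|].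
    change (psum f n + f n = if le_lt_dec (S n) j then 0 else f j).
    rewrite IH. destruct (le_lt_dec n j), (le_lt_dec (S n) j); try lia.
    - rewrite Hf by lia; ring.
    - replace n with j by lia; ring.
    - rewrite (Hf n) by lia; ring. }
  apply (is_lim_seq_ext_loc (fun _ => f j) (sum_n f) (f j)).
  - exists j. intros n Hn. rewrite <- psum_sum_n, H.
    destruct (le_lt_dec (S n) j); [lia|reflexivity].
  - apply is_lim_seq_const.
Qed.

Lemma l2_delta (j : nat) : l2 (delta j).
Proof.
  exists (Cmod (delta j j) ^ 2).
  apply (is_series_single (fun n => Cmod (delta j n) ^ 2)).
  intros n Hn. rewrite delta_other, Cmod_0 by exact Hn. ring.
Qed.

(** A resolvent at [x] would produce a square summable [w] with
    [(x - J) w = delta 0]. By the decay from infinity [w] vanishes far out, then,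
    since no off-diagonal entry is zero, in all rows by backward recursion, and
    this contradicts row 0. *)
Lemma interior_in_spectrum (a b c : cseq) (x : R) :
  ex_series (fun n => Cmod (1 - c n)%C) -> (forall n, (a n * c n)%C <> RtoC 0) ->
  ex_series (Delta_term a b c) -> -2 < x < 2 ->
  spectrum (jacobi a b c) (RtoC x).
Proof.
  intros Hc Hac HD Hx [T [[HTl2 _] HT]].
  set (w := T (delta O)).
  assert (Hw : l2 w) by (apply HTl2, l2_delta).
  assert (Heq : forall n, (RtoC x * w n - jacobi a b c w n)%C = delta O n)
    by (intros n; apply (proj2 (HT (delta O) (l2_delta O)))).
  assert (Hc0 : forall n, c n <> RtoC 0)
    by (intros n E; apply (Hac n); rewrite E; ring).
  destruct (unit_joukowski_preimage x Hx) as [k [Hk0 [Hk [Hk2 Hz]]]].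
  set (V := monic c w).
  set (A := fun n => (prepend_one a n * prepend_one c n)%C).
  assert (HV : forall n,
            V (S (S (S n)))
            = ((RtoC x - b (S n)) * V (S (S n)) - A (S n) * V (S n))%C).
  { intros n. apply monic_rec. specialize (Heq (S n)).
    rewrite delta_other in Heq by lia.
    replace (jacobi a b c w (S n))
      with (RtoC x * w (S n) - (RtoC x * w (S n) - jacobi a b c w (S n)))%C
      by ring.
    rewrite Heq. ring. }
  set (W := twist k V).
  (* The recursion fails in row 0, hence the shift by one index. *)
  destruct (forced_decaying_eventually_zero (k ^ 2) (fun n => W (S n))
              (fun n => forcing A b k W (S n))
              (fun n => perturbation a b c (S n))) as [N HN].
  - rewrite Cmod_pow, Hk. apply pow1.
  - exact Hk2.
  - intros n. now apply twist_forced with (RtoC x).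
  - apply (is_lim_seq_incr_1 (fun n => Cmod (W n))).
    apply twist_decays; [lra|]. now apply monic_decays.
  - intros n. apply perturbation_nonneg.
  - apply (ex_series_incr_1 (perturbation a b c)).
    apply ex_series_psum_bounded with (Series (Delta_term a b c)).
    + apply perturbation_nonneg.
    + intros n. eapply Rle_trans; [apply psum_perturbation|].
      apply psum_le_Series; [apply Delta_term_nonneg | exact HD].
  - intros n B H0 H1.
    rewrite <- (Rmult_1_l (perturbation a b c (S n))), <- Hk.
    apply forcing_bound; [lra|exact H0|exact H1].
  - assert (HV0 : forall n, (S N <= n)%nat -> V n = RtoC 0).
    { intros [|n] Hn; [lia|]. apply NNPP; intros HVn.
      apply (Cmult_neq_0 (k ^ S n) (V (S n)));
        [now apply Cpow_nz | exact HVn |]. apply HN. lia. }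
    (* Row [n] is solved for the entry left of the diagonal. *)
    assert (Hback : forall j n, (S N <= n + j)%nat -> (1 <= n)%nat ->
              V n = RtoC 0).
    { induction j as [|j IH]; intros n Hn Hn1; [apply HV0; lia|].
      destruct n as [|n]; [lia|]. specialize (HV n).
      rewrite (IH (S (S n))), (IH (S (S (S n)))) in HV by lia.
      apply NNPP; intros HVn.
      apply (Cmult_neq_0 (A (S n)) (V (S n)));
        [exact (Hac n) | exact HVn |].
      replace (A (S n) * V (S n))%C
        with ((RtoC x - b (S n)) * 0
              - ((RtoC x - b (S n)) * 0 - A (S n) * V (S n)))%C by ring.
      rewrite <- HV. ring. }
    assert (Hwz : forall n, w n = RtoC 0).
    { intros n. apply NNPP; intros Hwn.
      apply (Cmult_neq_0 (cprod c n) (w n));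
        [now apply cprod_nonzero | exact Hwn |].
      apply (Hback (S N) (S n)); lia. }
    specialize (Heq O). rewrite delta_same in Heq.
    unfold jacobi in Heq. rewrite !Hwz in Heq.
    apply (f_equal Re) in Heq. simpl in Heq. lra.
Qed.

Lemma isolated_not_in_segment (a b c : cseq) (z : C) :
  ex_series (fun n => Cmod (1 - c n)%C) -> (forall n, (a n * c n)%C <> RtoC 0) ->
  ex_series (Delta_term a b c) ->
  isolated_in_spectrum (jacobi a b c) z -> ~ segment22 z.
Proof.
  intros Hc Hac HD [_ [eps [Heps Hiso]]] [x [Hx Hz]].
  assert (Hy : exists y, -2 < y < 2 /\ 0 < Rabs (y - x) < eps).
  { set (t := Rmin (eps / 2) 1).
    assert (Ht : 0 < t <= eps / 2 /\ t <= 1).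
    { unfold t; split; [split|]; [apply Rmin_glb_lt; lra | apply Rmin_l
                                 | apply Rmin_r]. }
    destruct (Rle_dec x 0).
    - exists (x + t). replace (x + t - x) with t by ring.
      rewrite Rabs_pos_eq by lra. lra.
    - exists (x - t). replace (x - t - x) with (- t) by ring.
      rewrite Rabs_Ropp, Rabs_pos_eq by lra. lra. }
  destruct Hy as [y [Hy Hd]].
  apply (Hiso (RtoC y)).
  - rewrite Hz, <- RtoC_minus, Cmod_R. exact Hd.
  - now apply interior_in_spectrum.
Qed.

(** * Diagonals of trace class matrices *)
Lemma l2_add (u v : cseq) : l2 u -> l2 v -> l2 (fun n => (u n + v n)%C).
Proof.
  intros Hu Hv.
  apply (ex_series_dominated _ (fun n => 2 * (Cmod (u n) ^ 2 + Cmod (v n) ^ 2))).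
  - intros n. split; [apply pow2_ge_0|].
    pose proof (Cmod_ge_0 (u n + v n)%C).
    pose proof (Cmod_triangle (u n) (v n)).
    pose proof (pow2_ge_0 (Cmod (u n) - Cmod (v n))). nra.
  - apply (ex_series_scal_l 2 (fun n => Cmod (u n) ^ 2 + Cmod (v n) ^ 2)).
    now apply (ex_series_plus (fun n => Cmod (u n) ^ 2)
                 (fun n => Cmod (v n) ^ 2)).
Qed.

Lemma l2_scal (x : C) (u : cseq) : l2 u -> l2 (fun n => (x * u n)%C).
Proof.
  intros Hu.
  apply (ex_series_ext (fun n => Cmod x ^ 2 * Cmod (u n) ^ 2)).
  - intros n. rewrite Cmod_mult. simpl; ring.
  - now apply (ex_series_scal_l (Cmod x ^ 2) (fun n => Cmod (u n) ^ 2)).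
Qed.

Lemma l2_sub (u v : cseq) : l2 u -> l2 v -> l2 (cseq_sub u v).
Proof.
  intros Hu Hv.
  apply (ex_series_ext (fun n => Cmod (u n + - (1) * v n)%C ^ 2)).
  - intros n. unfold cseq_sub. do 2 f_equal. ring.
  - apply (l2_add u (fun n => - (1) * v n)%C); [exact Hu | now apply l2_scal].
Qed.

Lemma l2_schmidt_sum (s : nat -> R) (e f : nat -> cseq) (u : cseq) (N : nat) :
  (forall i, l2 (f i)) -> l2 (schmidt_sum s e f u N).
Proof.
  intros Hf; induction N as [|N IH]; simpl.
  - exists 0. apply (is_series_ext (fun _ => 0)).
    + intros n. rewrite Cmod_0. symmetry. apply Rmult_0_l.
    + apply (is_series_single (fun _ => 0) 0). reflexivity.
  - apply l2_add; [exact IH|]. now apply l2_scal.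
Qed.

Lemma Cmod_le_l2norm (u : cseq) (n : nat) : l2 u -> Cmod (u n) <= l2norm u.
Proof.
  intros Hu. unfold l2norm. rewrite <- (sqrt_pow2 (Cmod (u n))) by apply Cmod_ge_0.
  apply sqrt_le_1_alt.
  assert (Hp : forall k, 0 <= Cmod (u k) ^ 2) by (intros; apply pow2_ge_0).
  pose proof (psum_le_Series (fun k => Cmod (u k) ^ 2) (S n) Hp Hu) as H.
  simpl psum in H.
  pose proof (psum_nonneg (fun k => Cmod (u k) ^ 2) n Hp). simpl in *. lra.
Qed.

Lemma l2inner_delta (j : nat) (e : cseq) : l2inner (delta j) e = Cconj (e j).
Proof.
  assert (H : forall g : C -> R, g (RtoC 0) = 0 ->
            Series (fun n => g (delta j n * Cconj (e n))%C) = g (Cconj (e j))).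
  { intros g Hg.
    rewrite (is_series_unique _ (g (delta j j * Cconj (e j))%C)).
    - rewrite delta_same. f_equal. ring.
    - apply (is_series_single (fun n => g (delta j n * Cconj (e n))%C)).
      intros n Hn. rewrite delta_other by exact Hn. rewrite Cmult_0_l. exact Hg. }
  unfold l2inner. rewrite (H Re), (H Im) by reflexivity.
  symmetry; apply surjective_pairing.
Qed.

Lemma orthonormal_psum (e : nat -> cseq) (i q n : nat) :
  orthonormal e -> psum (fun k => Cmod (e i (k + q)%nat) ^ 2) n <= 1.
Proof.
  intros [Hl [H1 _]].
  rewrite (psum_shift (fun k => Cmod (e i k) ^ 2)).
  assert (Hp : forall k, 0 <= Cmod (e i k) ^ 2) by (intros; apply pow2_ge_0).
  pose proof (psum_le_Series (fun k => Cmod (e i k) ^ 2) (n + q) Hp (Hl i)) as H.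
  pose proof (psum_nonneg (fun k => Cmod (e i k) ^ 2) q Hp) as H0.
  specialize (H1 i). apply (f_equal Re) in H1. simpl in H1.
  rewrite (Series_ext _ (fun k => Cmod (e i k) ^ 2)) in H1; [simpl in *; lra|].
  intros k. rewrite Cmod2_alt. unfold Re, Im. simpl. ring.
Qed.

(** The [i]-th term contributes [s i * sum_n |e i (n+q)| |f i (n+r)|], and the
    inner sum is at most 1 by the arithmetic-geometric mean inequality, since
    [e i] and [f i] are unit vectors. The offsets [q] and [r] select a
    diagonal. *)
Lemma schmidt_sum_diagonal (s : nat -> R) (e f : nat -> cseq) (q r N K : nat) :
  (forall i, 0 <= s i) -> orthonormal e -> orthonormal f ->
  psum (fun n => Cmod (schmidt_sum s e f (delta (n + q)) N (n + r)%nat)) K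
  <= psum s N.
Proof.
  intros Hs He Hf. induction N as [|N IH]; simpl.
  - rewrite (psum_ext _ (fun _ => 0 * 0)), psum_scal; [lra|].
    intros; rewrite Cmod_0; ring.
  - eapply Rle_trans; [apply psum_le; intros n; apply Cmod_triangle|].
    rewrite psum_plus. apply Rplus_le_compat; [exact IH|].
    eapply Rle_trans.
    + apply (psum_le _ (fun n => s N / 2 *
        (Cmod (e N (n + q)%nat) ^ 2 + Cmod (f N (n + r)%nat) ^ 2))).
      intros n. rewrite !Cmod_mult, l2inner_delta, Cmod_conj, Cmod_R.
      rewrite Rabs_pos_eq by apply Hs.
      pose proof (pow2_ge_0
        (Cmod (e N (n + q)%nat) - Cmod (f N (n + r)%nat))) as Hsq.
      specialize (Hs N). nra.
    + rewrite psum_scal, psum_plus.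
      pose proof (orthonormal_psum e N q K He).
      pose proof (orthonormal_psum f N r K Hf).
      specialize (Hs N). nra.
Qed.

(** Finitely many matrix entries of [T] are approximated simultaneously by those
    of the Schmidt sums, whose sums along the diagonal are bounded by the trace
    norm. *)
Lemma trace_class_diagonal (T : cseq -> cseq) (q r : nat) :
  trace_class T ->
  ex_series (fun n => Cmod (T (delta (n + q)) (n + r)%nat)).
Proof.
  intros [[HT _] [s [e [f [Hs [Hsum [He [Hf Hlim]]]]]]]].
  apply ex_series_psum_bounded with (Series s); [intros; apply Cmod_ge_0|].
  intros K.
  set (err := fun N n => l2norm (cseq_sub (T (delta (n + q)))
                                   (schmidt_sum s e f (delta (n + q)) N))).
  assert (H : forall N,
            psum (fun n => Cmod (T (delta (n + q)) (n + r)%nat)) K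
            <= Series s + psum (err N) K).
  { intros N. eapply Rle_trans.
    - apply (psum_le _ (fun n =>
        Cmod (schmidt_sum s e f (delta (n + q)) N (n + r)%nat) + err N n)).
      intros n. unfold err.
      set (x := cseq_sub _ _).
      replace (T (delta (n + q)) (n + r)%nat) with
        (schmidt_sum s e f (delta (n + q)) N (n + r)%nat + x (n + r)%nat)%C
        by (unfold x, cseq_sub; ring).
      eapply Rle_trans; [apply Cmod_triangle|].
      apply Rplus_le_compat_l, Cmod_le_l2norm, l2_sub.
      + apply HT, l2_delta.
      + apply l2_schmidt_sum, Hf.
    - rewrite psum_plus. apply Rplus_le_compat_r.
      eapply Rle_trans; [now apply schmidt_sum_diagonal|].
      now apply psum_le_Series. }
  assert (Herr : is_lim_seq (fun N => psum (err N) K) 0).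
  { clear H. induction K as [|K IH]; simpl; [apply is_lim_seq_const|].
    rewrite <- (Rplus_0_r 0).
    apply (is_lim_seq_plus' (fun N => psum (err N) K) (fun N => err N K));
      [exact IH|].
    apply Hlim, l2_delta. }
  assert (Hl : is_lim_seq (fun N => Series s + psum (err N) K) (Series s + 0))
    by (apply is_lim_seq_plus'; [apply is_lim_seq_const | exact Herr]).
  pose proof (is_lim_seq_le _ _ _ _ H (is_lim_seq_const _) Hl) as Hle.
  simpl in Hle. lra.
Qed.

Lemma trace_class_coefficients (a b c : cseq) :
  trace_class (fun u => cseq_sub (jacobi a b c u) (jacobi0 u)) ->
  ex_series (fun n => Cmod (1 - a n)%C) /\
  ex_series (fun n => Cmod (b n)) /\
  ex_series (fun n => Cmod (1 - c n)%C).
Proof.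
  intros H. split; [|split].
  - apply (ex_series_ext (fun n => Cmod (cseq_sub
      (jacobi a b c (delta (n + 0))) (jacobi0 (delta (n + 0))) (n + 1)%nat)));
      [|exact (trace_class_diagonal _ 0 1 H)].
    intros n. rewrite <- (Cmod_opp (1 - a n)%C). f_equal.
    rewrite Nat.add_0_r, Nat.add_1_r.
    unfold cseq_sub, jacobi0, jacobi.
    rewrite delta_same, !delta_other by lia. ring.
  - apply (ex_series_ext (fun n => Cmod (cseq_sub
      (jacobi a b c (delta (n + 0))) (jacobi0 (delta (n + 0))) (n + 0)%nat)));
      [|exact (trace_class_diagonal _ 0 0 H)].
    intros n. f_equal. rewrite Nat.add_0_r.
    unfold cseq_sub, jacobi0, jacobi.
    rewrite delta_same, (delta_other n (S n)) by lia.
    destruct n as [|m]; [ring|]. rewrite (delta_other (S m) m) by lia. ring.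
  - apply (ex_series_ext (fun n => Cmod (cseq_sub
      (jacobi a b c (delta (n + 1))) (jacobi0 (delta (n + 1))) (n + 0)%nat)));
      [|exact (trace_class_diagonal _ 1 0 H)].
    intros n. rewrite <- (Cmod_opp (1 - c n)%C). f_equal.
    rewrite Nat.add_0_r, Nat.add_1_r.
    unfold cseq_sub, jacobi0, jacobi.
    rewrite delta_same, (delta_other (S n) n) by lia.
    destruct n as [|m]; [ring|]. rewrite (delta_other (S (S m)) m) by lia. ring.
Qed.

(** Since [1 - a c = (1 - a) + a (1 - c)] and [a] is bounded. *)
Lemma Delta_term_summable (a b c : cseq) (M : R) :
  (forall n, Cmod (a n) <= M) ->
  ex_series (fun n => Cmod (1 - a n)%C) ->
  ex_series (fun n => Cmod (b n)) ->
  ex_series (fun n => Cmod (1 - c n)%C) ->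
  ex_series (Delta_term a b c).
Proof.
  intros HM Ha Hb Hc.
  apply (ex_series_dominated _ (fun n => Cmod (b n)
           + (Cmod (1 - a n)%C + M * Cmod (1 - c n)%C))).
  - intros n. split; [apply Delta_term_nonneg|].
    apply Rplus_le_compat_l.
    replace (1 - a n * c n)%C with ((1 - a n) + a n * (1 - c n))%C by ring.
    eapply Rle_trans; [apply Cmod_triangle|]. rewrite Cmod_mult.
    apply Rplus_le_compat_l, Rmult_le_compat_r; [apply Cmod_ge_0 | apply HM].
  - apply (ex_series_plus (fun n => Cmod (b n))); [exact Hb|].
    apply (ex_series_plus (fun n => Cmod (1 - a n)%C)); [exact Ha|].
    now apply (ex_series_scal_l M (fun n => Cmod (1 - c n)%C)).
Qed.

(** * The discrete spectrum *)
Theorem theorem0p3 (a b c : cseq)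
  (Hbounded : exists M : R, forall k : nat,
     Cmod (a k) <= M /\ Cmod (b k) <= M /\ Cmod (c k) <= M)
  (Hnonzero : forall k : nat, (a k * c k)%C <> RtoC 0)
  (Htrace : trace_class (fun u => cseq_sub (jacobi a b c u) (jacobi0 u))) :
  (forall z : C, discrete_spectrum (jacobi a b c) z ->
     ~ segment22 z /\
     Cmod (z ^ 2 - 4)%C <= (2 * Series (Delta_term a b c) / ln 2) ^ 2)
  /\
  (ex_series (Delta1_term a b c) ->
   Series (Delta1_term a b c) < ln 2 ->
   forall z : C, ~ discrete_spectrum (jacobi a b c) z).
Proof.
  destruct (trace_class_coefficients a b c Htrace) as [Ha [Hb Hc]].
  destruct Hbounded as [M HM].
  assert (HD : ex_series (Delta_term a b c))
    by (apply (Delta_term_summable a b c M); auto; intros n; apply HM).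
  assert (Hc0 : forall n, c n <> RtoC 0)
    by (intros n E; apply (Hnonzero n); rewrite E; ring).
  split.
  - intros z [Hiso [Heig _]]. split.
    + exact (isolated_not_in_segment a b c z Hc Hnonzero HD Hiso).
    + exact (eigenvalue_in_Cassini_oval a b c z Hc Hc0 HD Heig).
  - intros HD1 Hlt z [_ [Heig _]].
    exact (no_eigenvalue_small_first_moment a b c z Hc Hc0 HD1 Hlt Heig).
Qed.
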